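(* Let $m\ge 3$, $k\in\{2,\dots,m-1\}$, and let $u:\mathbb{T}_m\to\mathbb{R}$. Then $u$ is $k$-quasiconvex if and only if $$u(x)\le \min_{\substack{y_1,\dots,y_k\in\mathcal{S}(x)\\ y_i\ne y_j \text{ for } i\neq j}}\ \max_{i=1,\dots,k} u(y_i)\qquad\text{for every } x\in\mathbb{T}_m .$$
   Context: The regular tree $\mathbb{T}_m$ with $m$-branching is the infinite directed graph whose vertices are the empty sequence $\emptyset$ (the root) and all finite sequences $(a_1,\dots,a_l)$, $l\in\mathbb{N}$, with $a_i\in\{0,1,\dots,m-1\}$. Each vertex $x$ has exactly $m$ successors, obtained by appending one coordinate: $\mathcal{S}(x)=\{(x,i): i\in\{0,\dots,m-1\}\}$; edges go from a vertex to its successors. For a vertex $x$, $\mathbb{T}_k^x$ denotes the collection of finite directed subgraphs (subtrees) $\mathbb{B}$ of $\mathbb{T}_m$ with root $x$ and $k$-branching, i.e. every node of $\mathbb{B}$ that is not a terminal node has exactly $k$ successors in $\mathbb{B}$. $\mathcal{E}(\mathbb{B})$ denotes the set of terminal nodes of $\mathbb{B}$. A set $C\subset\mathbb{T}_m$ is $k$-convex if for every vertex $x$ and every $\mathbb{B}\in\mathbb{T}_k^x$ with $\mathcal{E}(\mathbb{B})\subset C$ one has $x\in C$. A function $u:\mathbb{T}_m\to\mathbb{R}$ is $k$-quasiconvex if for every $\alpha\in\mathbb{R}$ the sublevel set $S_\alpha(u)=\{x\in\mathbb{T}_m: u(x)\le\alpha\}$ is $k$-convex. *)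

(* Defs.v *)
From mathcomp Require Import all_boot all_order all_algebra finmap.
From mathcomp Require Import all_classical all_reals.

Set Implicit Arguments.
Unset Strict Implicit.
Unset Printing Implicit Defensive.

Import Order.TTheory GRing.Theory Num.Theory.

Local Open Scope fset_scope.
Local Open Scope ring_scope.

(* The vertices of the regular tree T_m: the root is [::], and (x, i) is
   rcons x i. A notation rather than a definition, so that the choiceType
   structure of sequences is found. *)
Notation vertex m := (seq 'I_m).

Definition succs m (x : vertex m) : {fset vertex m} :=
  [fset rcons x i | i in 'I_m].

Definition edge m (x y : vertex m) : bool := y \in succs x.

(* A finite subtree with root x is given by its set of vertices B, all of which
   are reached from x by a directed path inside B. Its edges need not be
   recorded: a vertex y <> x of B has a unique predecessor in T_m, so the edge
   into y is forced, and the edges of the subtree are all those of T_m between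
   vertices of B. *)
Definition rooted_subtree m (x : vertex m) (B : {fset vertex m}) : Prop :=
  x \in B /\
  forall y, y \in B ->
    exists p : seq (vertex m),
      [/\ path (@edge m) x p, all (mem B) p & last x p = y].

Definition succs_in m (B : {fset vertex m}) (y : vertex m) : {fset vertex m} :=
  B `&` succs y.

Definition terminal_nodes m (B : {fset vertex m}) : {fset vertex m} :=
  [fset y in B | succs_in B y == fset0].

Definition branching m (k : nat) (B : {fset vertex m}) : Prop :=
  forall y, y \in B -> y \notin terminal_nodes B -> #|` succs_in B y| = k.

Definition branching_subtree m (k : nat) (x : vertex m) (B : {fset vertex m}) :
    Prop :=
  rooted_subtree x B /\ branching k B.

Definition kconvex m (k : nat) (C : set (vertex m)) : Prop :=
  forall (x : vertex m) (B : {fset vertex m}),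
    branching_subtree k x B ->
    (forall y, y \in terminal_nodes B -> C y) -> C x.

Definition sublevel (R : realType) m (u : vertex m -> R) (alpha : R) :
    set (vertex m) :=
  [set x | u x <= alpha]%classic.

Definition kquasiconvex (R : realType) m (k : nat) (u : vertex m -> R) : Prop :=
  forall alpha : R, kconvex k (sublevel u alpha).

(* The minimum over the k-tuples of pairwise distinct successors of x of the
   maximum of u on the tuple. It is taken in \bar R, where the neutral elements
   +oo and -oo exist; for 0 < k <= m both families are nonempty, so it is the
   real min-max. *)
Definition minmax_succs (R : realType) m (k : nat) (u : vertex m -> R)
    (x : vertex m) : \bar R :=
  (\big[mine/+oo]_(y : {ffun 'I_k -> succs x} | injectiveb y)
     \big[maxe/-oo]_(i < k) (u (val (y i)))%:E)%E.

(* Main.v *)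
Require Import Defs.
From mathcomp Require Import all_boot all_order all_algebra finmap.
From mathcomp Require Import all_classical all_reals.
From mathcomp Require Import zify.

(** For [0 < k], a set is [k]-convex if and only if it contains every vertex that
    has [k] successors in the set ([kconvexP]). Indeed a vertex together with [k]
    of its successors is itself a [k]-branching tree whose terminal nodes are
    those successors, and conversely membership climbs from the terminal nodes of a finite
    [k]-branching tree to its root, one level at a time. On the other side,
    [u x] is below the min-max exactly when every [k]-element set of successors
    of [x] contains some [y] with [u x <= u y] ([le_minmax_succsP]).

    The theorem compares these two one-step conditions. If [u y <= alpha] on a
    [k]-set [S] of successors, a [y] of [S] with [u x <= u y] yields
    [u x <= alpha]; conversely, applying [k]-convexity at the level
    [alpha = max_S u] gives [u x <= u y] for the [y] at which the maximum is
    attained. *)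

Import Order.TTheory.

Local Open Scope fset_scope.

Lemma succsP {m} (x y : vertex m) : reflect (exists i, y = rcons x i) (y \in succs x).
Proof.
rewrite /succs; apply: (iffP (imfsetP _ _ _ _)) => [[i _ ->]|[i ->]].
  by exists i.
by exists i.
Qed.

Lemma size_succs {m} (x y : vertex m) : y \in succs x -> size y = (size x).+1.
Proof. by case/succsP=> i ->; rewrite size_rcons. Qed.

Lemma succs_in_star {m} (x : vertex m) (S : {fset vertex m}) :
  S `<=` succs x -> succs_in (x |` S) x = S.
Proof.
move=> /fsubsetP sub; apply/fsetP => y; rewrite !inE.
have [yS|yS] := boolP (y \in S); first by rewrite orbT sub.
rewrite orbF; apply/negP => /andP[/eqP -> /size_succs].
exact: n_Sn.
Qed.

(** No vertex of the star is longer than an element of [S], whereas a successor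
    would be. *)
Lemma succs_in_star_leaf {m} {x y : vertex m} {S : {fset vertex m}} :
  S `<=` succs x -> y \in S -> succs_in (x |` S) y = fset0.
Proof.
move=> /fsubsetP sub /sub /size_succs sy; apply/fsetP => z; rewrite !inE.
apply/negP => /andP[zB /size_succs]; rewrite sy.
case/orP: zB => [/eqP ->|/sub /size_succs ->]; lia.
Qed.

Lemma branching_star {m} (x : vertex m) (S : {fset vertex m}) :
  S `<=` succs x -> branching_subtree #|` S| x (x |` S).
Proof.
move=> sub; split; first split; first by rewrite !inE eqxx.
  move=> y; rewrite !inE => /orP[/eqP ->|yS]; first by exists [::].
  exists [:: y]; split=> //=; last by rewrite !inE yS orbT.
  by rewrite andbT; apply: (fsubsetP sub).
move=> y; rewrite !inE => /orP[/eqP ->|yS]; first by rewrite succs_in_star.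
by rewrite (succs_in_star_leaf sub yS) yS eqxx orbT.
Qed.

Lemma terminal_nodes_star {m} {x : vertex m} {S : {fset vertex m}} :
  S `<=` succs x -> S != fset0 -> terminal_nodes (x |` S) `<=` S.
Proof.
move=> sub S0; apply/fsubsetP => y; rewrite !inE.
by case/andP=> /orP[/eqP ->|//]; rewrite succs_in_star // (negbTE S0).
Qed.

(** One step of the tree suffices: stars give one direction, and the other is an
    induction from the terminal nodes towards the root. Positivity of [k] ensures
    that the centre of a star is not one of its terminal nodes. *)
Lemma kconvexP {m k} (C : set (vertex m)) : (0 < k)%N ->
  kconvex k C <->
  (forall (x : vertex m) (S : {fset vertex m}), S `<=` succs x -> #|` S| = k ->
     (forall y, y \in S -> C y) -> C x).
Proof.
move=> k0; split=> [Cconv x S sub Sk SC | step x B [[xB _] Bk] termC].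
  apply: (Cconv x (x |` S)); first by rewrite -Sk; apply: branching_star.
  move=> y /(fsubsetP (terminal_nodes_star sub _)) yS; apply/SC/yS.
  by rewrite -cardfs_gt0 Sk.
pose N := \max_(y : B) size (val y).
have size_le y : y \in B -> (size y <= N)%N.
  by move=> yB; apply: (leq_bigmax [` yB]).
(* Climbing to the root is an induction on [N - size y], which decreases from a
   node to its successors in the tree because [N] bounds their lengths. *)
suff climb n y : y \in B -> (N - size y < n)%N -> C y.
  by apply: (climb N.+1 x xB); rewrite ltnS leq_subr.
elim: n y => // n IHn y yB yn.
have [yt|yt] := boolP (y \in terminal_nodes B); first exact: termC.
apply: (step y (succs_in B y)); [exact: fsubsetIr | exact: Bk |].
move=> z; rewrite inE => /andP[zB /size_succs sz].
apply: IHn => //; have := size_le z zB; rewrite sz => ylt.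
exact: leq_trans (ltn_sub2l ylt (ltnSn _)) yn.
Qed.

(** This trades the tuples of the min-max for sets of successors, the form in
    which a subtree presents them. *)
Lemma fset_injective_tuple {K : choiceType} {k} {A S : {fset K}} :
  S `<=` A -> #|` S| = k ->
  exists2 y : {ffun 'I_k -> A}, injective y & forall i, val (y i) \in S.
Proof.
move=> sub Sk.
have sizeS : k = #|{: S}| by rewrite -Sk cardfE.
exists [ffun i => fincl sub (enum_val (cast_ord sizeS i))]; last first.
  by move=> i; rewrite ffunE /=; apply: valP.
move=> i j; rewrite !ffunE => /(congr1 val) /= /val_inj /enum_val_inj.
exact: cast_ord_inj.
Qed.

Lemma le_minmax_succsP {R : realType} {m k} (u : vertex m -> R) (x : vertex m) :
  ((u x)%:E <= minmax_succs k u x)%E <->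
  (forall S : {fset vertex m}, S `<=` succs x -> #|` S| = k ->
     exists2 y, y \in S & (u x <= u y)%R).
Proof.
split=> [/bigmin_geP[_ h] S sub Sk | h].
  have [y yinj yS] := fset_injective_tuple sub Sk.
  have /bigmax_geP[//|[i _]] := h y (introT (injectiveP y) yinj).
  by rewrite lee_fin => le; exists (val (y i)).
apply/bigmin_geP; split=> [|y /injectiveP yinj]; first exact: leey.
have [||z /imfsetP[i _ ->] le] := h [fset val (y i) | i in 'I_k].
- by apply/fsubsetP => z /imfsetP[i _ ->]; apply: valP.
- by rewrite card_imfset /= ?size_enum_ord // => i j /val_inj /yinj.
by apply/bigmax_geP; right; exists i; rewrite ?lee_fin.
Qed.

Theorem theorem2p3 (R : realType) (m k : nat) (u : vertex m -> R)
    (hm : (3 <= m)%N) (hk : (2 <= k <= m - 1)%N) :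
  kquasiconvex k u <->
  (forall x : vertex m, ((u x)%:E <= minmax_succs k u x)%E).
Proof.
have k0 : (0 < k)%N by case/andP: hk => /ltnW.
split=> [qc x | h alpha].
  apply/le_minmax_succsP => S sub Sk.
  have [y0 y0S] : exists y0, y0 \in S by apply/fset0Pn; rewrite -cardfs_gt0 Sk.
  case: (@arg_maxP _ _ _ [` y0S] xpredT (fun y : S => u (val y)) isT) => y _ ymax.
  exists (val y); first exact: valP.
  apply: ((kconvexP _ k0).1 (qc (u (val y))) x S sub Sk) => z zS.
  exact: (ymax [` zS]).
apply/(kconvexP _ k0) => x S sub Sk Sle.
have [y yS le] := (le_minmax_succsP u x).1 (h x) S sub Sk.
exact: le_trans le (Sle y yS).
Qed.
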